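(* Let $k\in\{0,1,2,\dots\}$ and let $\Omega$ be a domain in the right quaternionic Heisenberg group $\mathscr H$. Then the sequence $$0\to C^\infty(\Omega,\mathscr V_0)\xrightarrow{\mathscr D_0}C^\infty(\Omega,\mathscr V_1)\xrightarrow{\mathscr D_1}C^\infty(\Omega,\mathscr V_2)\to\cdots\xrightarrow{\mathscr D_{2n-2}}C^\infty(\Omega,\mathscr V_{2n-1})\to0$$ is a complex, i.e. $\mathscr D_{j+1}\circ\mathscr D_j=0$ for each $j$.
   Context: The right quaternionic Heisenberg group is $\mathscr H=\mathbb H^n\times\operatorname{Im}\mathbb H\cong\mathbb R^{4n}\times\mathbb R^3$ with multiplication $(x,t)\cdot(y,s)=(x+y,\,t+s+2\operatorname{Im}(x\overline y))$, where $x\overline y=\sum_l x_l\overline{y_l}$. In real coordinates $(y_1,\dots,y_{4n},s_1,s_2,s_3)$ it has left invariant vector fields $$Y_{4l+j}=\frac{\partial}{\partial y_{4l+j}}+2\sum_{\beta=1}^3\sum_{m=1}^4 B^\beta_{mj}\,y_{4l+m}\frac{\partial}{\partial s_\beta},\qquad l=0,\dots,n-1,\ j=1,\dots,4,$$ $$B^1=\begin{pmatrix}0&-1&0&0\\1&0&0&0\\0&0&0&-1\\0&0&1&0\end{pmatrix},\quad B^2=\begin{pmatrix}0&0&-1&0\\0&0&0&1\\1&0&0&0\\0&-1&0&0\end{pmatrix},\quad B^3=\begin{pmatrix}0&0&0&-1\\0&0&-1&0\\0&1&0&0\\1&0&0&0\end{pmatrix}.$$ Complex vector fields $Z_A^{A'}$,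 $A=0,\dots,2n-1$, $A'=0',1'$: $Z_{2l}^{0'}=-Y_{4l+3}-\mathbf iY_{4l+4}$, $Z_{2l}^{1'}=-Y_{4l+1}-\mathbf iY_{4l+2}$, $Z_{2l+1}^{0'}=Y_{4l+1}-\mathbf iY_{4l+2}$, $Z_{2l+1}^{1'}=-Y_{4l+3}+\mathbf iY_{4l+4}$. Spaces: $\mathscr V_j=\odot^{k-j}\mathbb C^2\otimes\wedge^j\mathbb C^{2n}$ for $j=0,\dots,k$, and $\mathscr V_j=\odot^{j-k-1}\mathbb C^2\otimes\wedge^{j+1}\mathbb C^{2n}$ for $j=k+1,\dots,2n-1$. An element of $\odot^p\mathbb C^2\otimes\wedge^q\mathbb C^{2n}$ is a tuple of complex numbers with $p$ primed indices in $\{0',1'\}$, symmetric in them, and $q$ unprimed indices in $\{0,\dots,2n-1\}$, antisymmetric in them (the relative placement of primed and unprimed indices is immaterial). Round brackets denote symmetrisation over the primed indices enclosed, $f_{\cdots(A_1'\cdots A_p')\cdots}=\frac1{p!}\sum_{\sigma\in S_p}f_{\cdots A'_{\sigma(1)}\cdots A'_{\sigma(p)}\cdots}$, and square brackets denote antisymmetrisation over the unprimed indices enclosed, $f_{\cdots[A_1\cdots A_p]\cdots}=\frac1{p!}\sum_{\sigma\in S_p}\operatorname{sign}(\sigma)f_{\cdots A_{\sigma(1)}\cdots A_{\sigma(p)}\cdots}$; these also apply to indices distributed over several factors. Operators $\mathscr D_j:C^\infty(\Omega,\mathscr V_j)\to C^\infty(\Omega,\mathscr V_{j+1})$: for $j=0,\dots,k-1$,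 $$(\mathscr D_jf)_{A_0\cdots A_jA_1'\cdots A_{k-j-1}'}=(j+1)\sum_{A'=0',1'}Z_{[A_0}^{A'}f_{A_1\cdots A_j]A'A_1'\cdots A_{k-j-1}'};$$ for $j=k$, $$(\mathscr D_kf)_{A_1\cdots A_{k+2}}=(k+2)Z_{[A_1}^{0'}Z_{A_2}^{1'}f_{A_3\cdots A_{k+2}]};$$ for $j=k+1,\dots,2n-2$ (writing the symmetric primed indices as superscripts), $$(\mathscr D_jf)_{A_1\cdots A_{j+2}}^{A_1'\cdots A_{j-k}'}=(j+2)Z_{[A_1}^{(A_1'}f_{A_2\cdots A_{j+2}]}^{A_2'\cdots A_{j-k}')}.$$ *)

(* Defs.v *)
From mathcomp Require Import all_boot all_order all_algebra all_fingroup.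
From mathcomp Require Import complex.
From mathcomp Require Import classical_sets reals topology normedtype derive.

Set Implicit Arguments.
Unset Strict Implicit.
Unset Printing Implicit Defensive.

Import Order.TTheory GRing.Theory Num.Theory.
Import numFieldNormedType.Exports.

Local Open Scope classical_set_scope.
Local Open Scope ring_scope.
Local Open Scope complex_scope.

(* The underlying space R^{4n} x R^3 of the Heisenberg group: row [l] of the
   first component is the quaternion (y_{4l+1}, ..., y_{4l+4}). All indices are
   0-based. *)
Notation heis R n := ('M[R%type]_(n, 4) * 'rV[R%type]_3)%type.

Definition coord_index (n : nat) : Type := ('I_n * 'I_4 + 'I_3)%type.

Definition unit_vec (R : realType) (n : nat) (c : coord_index n) : heis R n :=
  match c with
  | inl (l, j) => (delta_mx l j, 0)
  | inr b => (0, delta_mx 0 b)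
  end.

Definition domain (R : realType) (n : nat) (Omega : set (heis R n)) : Prop :=
  [/\ open Omega, connected Omega & Omega !=set0].

Definition iter_partial (R : realType) (n : nat) (s : seq (coord_index n))
    (g : heis R n -> R) : heis R n -> R :=
  foldr (fun c h x => 'D_(unit_vec R c) h x) g s.

(* [g] is total, but only its restriction to the open set [Omega] matters. *)
Definition smooth_on (R : realType) (n : nat) (Omega : set (heis R n))
    (g : heis R n -> R) : Prop :=
  forall (s : seq (coord_index n)) (x : heis R n), Omega x ->
    {for x, continuous (iter_partial s g)} /\
    (forall c : coord_index n, derivable (iter_partial s g) x (unit_vec R c)).

Definition partialC (R : realType) (n : nat) (c : coord_index n)
    (g : heis R n -> R[i]) (x : heis R n) : R[i] :=
  'D_(unit_vec R c) (fun y => complex.Re (g y)) x +i*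
  'D_(unit_vec R c) (fun y => complex.Im (g y)) x.

Definition matB (R : realType) (b : 'I_3) : 'M[R]_4 :=
  let B1 := [:: [:: 0; -1; 0; 0]; [:: 1; 0; 0; 0];
                [:: 0; 0; 0; -1]; [:: 0; 0; 1; 0]] in
  let B2 := [:: [:: 0; 0; -1; 0]; [:: 0; 0; 0; 1];
                [:: 1; 0; 0; 0]; [:: 0; -1; 0; 0]] in
  let B3 := [:: [:: 0; 0; 0; -1]; [:: 0; 0; -1; 0];
                [:: 0; 1; 0; 0]; [:: 1; 0; 0; 0]] in
  \matrix_(m < 4, j < 4) nth 0 (nth [::] (nth [::] [:: B1; B2; B3] b) m) j.

Definition fieldY (R : realType) (n : nat) (l : 'I_n) (j : 'I_4)
    (g : heis R n -> R[i]) (x : heis R n) : R[i] :=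
  partialC (inl (l, j)) g x +
  2 * \sum_(b < 3) \sum_(m < 4)
        (matB R b m j * x.1 l m)%:C * partialC (inr b) g x.

Lemma half_index_subproof (n : nat) (A : 'I_(n.*2)) : (A./2 < n)%N.
Proof. by rewrite ltn_half_double. Qed.

Definition half_index (n : nat) (A : 'I_(n.*2)) : 'I_n :=
  Ordinal (half_index_subproof A).

(* [fieldZ A A'] is Z_A^{A'}; the primed index 0' is [ord0] and 1' is
   [ord_max]. *)
Definition fieldZ (R : realType) (n : nat) (A : 'I_(n.*2)) (A' : 'I_2)
    (g : heis R n -> R[i]) (x : heis R n) : R[i] :=
  let Y (j : 'I_4) := fieldY (half_index A) j g x in
  let Y1 := Y (@Ordinal 4 0 isT) in let Y2 := Y (@Ordinal 4 1 isT) in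
  let Y3 := Y (@Ordinal 4 2 isT) in let Y4 := Y (@Ordinal 4 3 isT) in
  match odd A, A' == ord0 with
  | false, true  => - Y3 - 'i * Y4
  | false, false => - Y1 - 'i * Y2
  | true,  true  => Y1 - 'i * Y2
  | true,  false => - Y3 + 'i * Y4
  end.

(* Arrays of complex numbers with [p] primed and [q] unprimed indices. *)
Definition tensor (R : realType) (n p q : nat) : Type :=
  p.-tuple 'I_2 -> q.-tuple 'I_(n.*2) -> R[i].

Definition permute (T : Type) (m : nat) (s : 'S_m) (t : m.-tuple T) :
    m.-tuple T := [tuple tnth t (s i) | i < m].

(* Membership in (sym^p C^2) (x) (alt^q C^{2n}). *)
Definition sym_alt (R : realType) (n p q : nat) (f : tensor R n p q) : Prop :=
  (forall (s : 'S_p) P A, f (permute s P) A = f P A) /\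
  (forall (s : 'S_q) P A, f P (permute s A) = (-1) ^+ s * f P A).

Definition sym (R : realType) (T : Type) (m : nat) (F : seq T -> R[i])
    (t : m.-tuple T) : R[i] :=
  (m`!%:R)^-1 * \sum_(s : 'S_m) F (permute s t).

Definition alt (R : realType) (T : Type) (m : nat) (F : seq T -> R[i])
    (t : m.-tuple T) : R[i] :=
  (m`!%:R)^-1 * \sum_(s : 'S_m) (-1) ^+ s * F (permute s t).

(* Component of a tensor at index lists; the default 0 is returned only for
   lists of the wrong length, which do not occur in [opD]. It spares casts
   between the provably equal index counts of V_j. *)
Definition entry (R : realType) (n p q : nat) (f : tensor R n p q)
    (P : seq 'I_2) (A : seq 'I_(n.*2)) : R[i] :=
  match insub P, insub A with
  | Some P', Some A' => f P' A'
  | _, _ => 0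
  end.

(* Numbers of primed and unprimed indices of V_j. *)
Definition pdeg (k j : nat) : nat :=
  if (j <= k)%N then (k - j)%N else (j - k - 1)%N.

Definition qdeg (k j : nat) : nat := if (j <= k)%N then j else j.+1.

(* Fields of arrays with the index counts of V_j; that the values lie in V_j is
   part of [Cinfty]. *)
Definition Vfield (R : realType) (n k j : nat) : Type :=
  heis R n -> tensor R n (pdeg k j) (qdeg k j).

Definition Cinfty (R : realType) (n k j : nat) (Omega : set (heis R n))
    (f : Vfield R n k j) : Prop :=
  (forall x, Omega x -> sym_alt (f x)) /\
  (forall P A, smooth_on Omega (fun x => complex.Re (f x P A)) /\
               smooth_on Omega (fun x => complex.Im (f x P A))).

Definition opD (R : realType) (n k j : nat) (f : Vfield R n k j) :
    Vfield R n k j.+1 :=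
  fun x P A =>
  if (j < k)%N then
    j.+1%:R * alt (fun B =>
      if B is B0 :: B' then
        \sum_(a < 2) fieldZ B0 a (fun y => entry (f y) (a :: P) B') x
      else 0) A
  else if j == k then
    k.+2%:R * alt (fun B =>
      if B is [:: B1, B2 & B'] then
        fieldZ B1 ord0 (fieldZ B2 ord_max (fun y => entry (f y) [::] B')) x
      else 0) A
  else
    j.+2%:R * alt (fun B => sym (fun Q =>
      match B, Q with
      | B1 :: B', Q1 :: Q' => fieldZ B1 Q1 (fun y => entry (f y) Q' B') x
      | _, _ => 0
      end) P) A.

(* Main.v *)
Require Import Defs.
From mathcomp Require Import all_boot all_order all_algebra all_fingroup.
From mathcomp Require Import complex.
From mathcomp Require Import classical_sets reals topology normedtype derive.
From mathcomp Require Import ring zify.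

Set Implicit Arguments.
Unset Strict Implicit.
Unset Printing Implicit Defensive.

Import Order.TTheory GRing.Theory Num.Theory.
Import numFieldNormedType.Exports.

Local Open Scope classical_set_scope.
Local Open Scope ring_scope.
Local Open Scope complex_scope.

(** The whole complex is exterior algebra over two anticommuting
first-order operators.  Write [d_a G] for the form with components
[Z_b^a G_B] at the index list [b :: B], and [Alt] for the antisymmetrisation
over the whole list.  Up to constants, the operator D_j is [Alt] applied to
[\sum_a d_a f_(a :: P)] when [j < k], to [d_0' d_1' f] when [j = k], and to the
symmetrisation over [Q] of [d_(head Q) f_(behead Q)] when [j > k].  Everything
follows from two rules, valid for smooth forms on an open set:

- [Alt (d_a (Alt G)) = Alt (d_a G)] ([alt_dform_alt]), since an inner average
  over permutations is absorbed by an outer one ([avg_absorb]);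
- [Alt (d_a d_b G) = - Alt (d_b d_a G)] ([alt_dform_anticomm]).

Indeed, for [j + 1 < k] the composition is a sum of [d_b d_a f_(a, b)],
antisymmetric in [(a, b)] times symmetric; for [j > k] it is the symmetrisation
over the primed indices of an expression antisymmetric in two of them; and in
the two cases next to [k] three operators [d_a d_b d_c] occur, two of which
agree because there are only two primed indices ([alt_dform_cube]).

The second rule is the identity
[[Z_A^a, Z_B^b] + [Z_A^b, Z_B^a] = 0] ([fieldZ_anticomm]).  The fields [Y] have
the form [d/dy + \sum_b w_b d/ds_b] with [w_b] linear in [y], so that
[[Y_(l, j), Y_(l', j')]] is [4 (B^b)_(j, j') d/ds_b] summed over [b] when
[l = l'], and zero otherwise ([fieldY_comm]); the identity is then a finite
verification on the coefficients of the [Z]'s in the [Y]'s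
([matB_form_zcoef_sym]).

The commutator of the [Y]'s uses that partial derivatives of smooth functions
commute ([derive_comm]).  That and the stability of smoothness under sums,
products and derivatives ([smooth_of_algebra]) are the analytic input. *)

(** * Symmetry of second derivatives *)

Lemma is_derive_line (R : realType) (V : normedModType R) (g : V -> R)
    (u p : V) (t : R) :
  derivable g (t *: u + p) u ->
  is_derive t (1 : R) (fun h : R => g (h *: u + p)) ('D_u g (t *: u + p)).
Proof.
have E : (fun h : R => h^-1 *: (((fun h => g (h *: u + p)) \o shift t) (h *: (1 : R))
     - g (t *: u + p))) =
  (fun h : R => h^-1 *: ((g \o shift (t *: u + p)) (h *: u) - g (t *: u + p))).
  by apply/boolp.funext => h /=; rewrite scalerDl addrA /GRing.scale /= mulr1.
by move=> dg; split; rewrite /derivable /derive E.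
Qed.

(** The second difference is symmetric in [u] and [v] whereas the limit is
not visibly so: comparing the two limits is what proves [derive_comm].  The mean
value theorem, used once in each direction, makes the quotient a value of
['D_v ('D_u g)] at a point that tends to [x]. *)
Lemma second_difference_cvg (R : realType) (V : normedModType R) (g : V -> R)
    (Om : set V) (u v x : V) :
  open Om -> Om x ->
  (forall y, Om y -> derivable g y u) ->
  (forall y, Om y -> derivable ('D_u g) y v) ->
  {for x, continuous ('D_v ('D_u g))} ->
  (fun h : R => (g (x + h *: u + h *: v) - g (x + h *: u) - g (x + h *: v)
       + g x) / h ^+ 2) @ 0^'+ --> 'D_v ('D_u g) x.
Proof.
move=> oOm Omx du dv cont.
apply/cvgrPdist_lt => e e0.
have [r /= r0 rP] : exists2 r : R, 0 < r &
    forall y, `|x - y| < r -> Om y /\ `|'D_v ('D_u g) x - 'D_v ('D_u g) y| < e.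
  have : \forall y \near x, Om y /\ `|'D_v ('D_u g) x - 'D_v ('D_u g) y| < e.
    near=> y; split; first by near: y; apply: open_nbhs_nbhs.
    by near: y; move/cvgrPdist_lt : cont; apply.
  by move=> /nbhs_normP[r /= r0 rP]; exists r => // y; apply: rP.
(* The parallelogram spanned at [x] by [h *: u] and [h *: v] stays in the ball
of radius [r] as soon as [h * (`|u| + `|v| + 1) < r]; the [1] covers
[u = v = 0]. *)
have B s t h : 0 <= s <= h -> 0 <= t <= h -> h * (`|u| + `|v| + 1) < r ->
    `|x - (s *: u + (t *: v + x))| < r.
  move=> /andP[s0 sh] /andP[t0 th]; apply: le_lt_trans.
  rewrite [t *: v + x]addrC addrCA opprD addNKr normrN.
  rewrite (le_trans (ler_normD _ _))// !normrZ !ger0_norm//.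
  rewrite !mulrDr mulr1 -addrA lerD ?ler_wpM2r// ler_wpDr ?ler_wpM2r//.
  by rewrite (le_trans s0).
near=> h.
have h0 : 0 < h by [].
have hr : h * (`|u| + `|v| + 1) < r.
  rewrite -ltr_pdivlMr ?ltr_wpDl ?addr_ge0//.
  near: h; apply: nbhs_right_lt; by rewrite divr_gt0// ltr_wpDl ?addr_ge0.
have hh : 0 <= h <= h by apply/andP; split => //; exact: ltW.
have zh : 0 <= (0:R) <= h by apply/andP; split => //; exact: ltW.
have itvP (s : R) : s \in `[0, h]%R -> 0 <= s <= h by rewrite in_itv.
have itvoP (s : R) : s \in `]0, h[%R -> 0 <= s <= h.
  by rewrite in_itv /= => /andP[? ?]; rewrite !ltW.
pose F (s : R) := g (s *: u + (h *: v + x)) - g (s *: u + x).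
pose F' (s : R) := 'D_u g (s *: u + (h *: v + x)) - 'D_u g (s *: u + x).
have dF (s : R) : 0 <= s <= h -> is_derive s (1:R) F (F' s).
  move=> sh; apply: is_deriveB; apply: is_derive_line; apply: du.
    by have [] := rP _ (B s h h sh hh hr).
  by have [] := rP _ (B s 0 h sh zh hr); rewrite scale0r add0r.
have [|||c ch FE] := @MVT R F F' 0 h.
- by [].
- by move=> s /itvoP; apply: dF.
- by apply: derivable_within_continuous => s /itvP /dF [].
pose G (t : R) := 'D_u g (t *: v + (c *: u + x)).
pose G' (t : R) := 'D_v ('D_u g) (t *: v + (c *: u + x)).
have {}ch := itvoP _ ch.
have dG (t : R) : 0 <= t <= h -> is_derive t (1:R) G (G' t).
  move=> th; apply: is_derive_line; apply: dv.
  by have [] := rP _ (B c t h ch th hr); rewrite addrCA.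
have [|||d dh GE] := @MVT R G G' 0 h.
- by [].
- by move=> s /itvoP; apply: dG.
- by apply: derivable_within_continuous => s /itvP /dG [].
have {}dh := itvoP _ dh.
have -> : g (x + h *: u + h *: v) - g (x + h *: u) - g (x + h *: v) + g x
   = 'D_v ('D_u g) (d *: v + (c *: u + x)) * h ^+ 2.
  transitivity (F h - F 0).
    rewrite /F !scale0r !add0r opprB [g x - _]addrC addrA.
    by rewrite -[x + _ + _]addrA addrC addrC (addrC x) (addrC x) (addrC x) addrA.
  have -> : F h - F 0 = (G h - G 0) * h.
    rewrite FE /G /F' subr0 scale0r add0r; congr ((_ - _) * _).
    by rewrite addrCA.
  by rewrite GE subr0 /G' expr2 mulrA.
rewrite mulfK ?expf_neq0 ?gt_eqF//.
have [_] := rP _ (B c d h ch dh hr).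
by rewrite addrCA.
Unshelve. all: by end_near. Qed.

Theorem derive_comm (R : realType) (V : normedModType R) (g : V -> R)
    (Om : set V) (u v x : V) :
  open Om -> Om x ->
  (forall y, Om y -> derivable g y u) ->
  (forall y, Om y -> derivable g y v) ->
  (forall y, Om y -> derivable ('D_u g) y v) ->
  (forall y, Om y -> derivable ('D_v g) y u) ->
  {for x, continuous ('D_v ('D_u g))} ->
  {for x, continuous ('D_u ('D_v g))} ->
  'D_v ('D_u g) x = 'D_u ('D_v g) x.
Proof.
move=> oOm Omx du dv duv dvu cuv cvu.
have A := second_difference_cvg oOm Omx du duv cuv.
have := second_difference_cvg oOm Omx dv dvu cvu.
under boolp.eq_fun => h do rewrite [x + _ + _]addrAC [_ - g (x + h *: v) - _]addrAC.
by move=> /(cvg_unique _ A); apply.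
Qed.

(** * Smooth functions and their partial derivatives *)

(** A derivative at a point of an open set depends only on the values on that
set; this lets every identity on [Om] be differentiated. *)
Lemma derive_eq_on (R : realType) (V : normedModType R) (Om : set V)
    (g h : V -> R) (v x : V) :
  open Om -> (forall y, Om y -> g y = h y) -> Om x -> 'D_v g x = 'D_v h x.
Proof.
move=> oOm gh Omx; apply: near_eq_derive; near=> y; apply: gh.
by near: y; apply: open_nbhs_nbhs.
Unshelve. all: by end_near. Qed.

Lemma derivable_eq_on (R : realType) (V : normedModType R) (Om : set V)
    (g h : V -> R) (v x : V) :
  open Om -> (forall y, Om y -> g y = h y) -> Om x ->
  derivable g x v -> derivable h x v.
Proof.
move=> oOm gh Omx; apply: near_eq_derivable; near=> y; apply: gh.
by near: y; apply: open_nbhs_nbhs.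
Unshelve. all: by end_near. Qed.

Lemma continuous_eq_on (R : realType) (V : normedModType R) (Om : set V)
    (g h : V -> R) (x : V) :
  open Om -> (forall y, Om y -> g y = h y) -> Om x ->
  {for x, continuous g} -> {for x, continuous h}.
Proof.
move=> oOm gh Omx cg; rewrite /prop_for /continuous_at -gh//.
apply: cvg_trans cg; apply: near_eq_cvg; near=> y; apply: gh.
by near: y; apply: open_nbhs_nbhs.
Unshelve. all: by end_near. Qed.

Definition horizontal_coord (R : realType) n (l : 'I_n) (m : 'I_4)
    (x : heis R n) : R :=
  x.1 l m.

Lemma is_derive_coord (R : realType) n (l : 'I_n) (m : 'I_4) (x v : heis R n) :
  is_derive x v (horizontal_coord l m) (v.1 l m).
Proof.
have E : (fun h : R => h^-1 *:
    ((horizontal_coord l m \o shift x) (h *: v) - horizontal_coord l m x)) @ 0^'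
    --> v.1 l m.
  apply: cvg_near_cst; near=> h.
  rewrite /horizontal_coord /= !mxE addrK [_ *: _]mulrA mulVf ?mul1r//.
  by near: h; exact: nbhs_dnbhs_neq.
by split; [apply/cvg_ex; exists (v.1 l m) | exact: cvg_lim].
Unshelve. all: by end_near. Qed.

Lemma continuous_coord (R : realType) n (l : 'I_n) (m : 'I_4) :
  continuous (@horizontal_coord R n l m).
Proof.
move=> x; apply: (@continuous_comp _ _ _ fst (fun M : 'M[R]_(n, 4) => M l m)).
  exact: cvg_fst.
exact: coord_continuous.
Qed.

Section Smooth.
Context {R : realType} {n : nat} {Om : set (heis R n)}.
Hypothesis oOm : open Om.
Implicit Types (g h : heis R n -> R) (c : coord_index n) (s : seq (coord_index n)).

Lemma iter_partial_eq_on s g h :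
  (forall y, Om y -> g y = h y) ->
  forall y, Om y -> iter_partial s g y = iter_partial s h y.
Proof. by move=> gh; elim: s => //= c s IH y Omy; apply: derive_eq_on Omy. Qed.

Lemma smooth_continuous g x : smooth_on Om g -> Om x -> {for x, continuous g}.
Proof. by move=> /(_ [::] x) sg /sg []. Qed.

Lemma smooth_derivable g c x :
  smooth_on Om g -> Om x -> derivable g x (unit_vec R c).
Proof. by move=> /(_ [::] x) sg /sg []. Qed.

Lemma smooth_derive g c :
  smooth_on Om g -> smooth_on Om (fun x => 'D_(unit_vec R c) g x).
Proof.
move=> sg s x Omx; have := sg (rcons s c) x Omx.
by rewrite /iter_partial foldr_rcons.
Qed.

(** The iterated derivatives of a product are awkward to bound by induction on
their order.  It is easier to close the smooth functions, the constants and the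
coordinates under sums and products: that class is stable under each partial
derivative, up to equality on [Om], and its members are continuous and
derivable, so that all of them are smooth. *)
Inductive smooth_algebra : (heis R n -> R) -> Prop :=
| AlgSmooth g : smooth_on Om g -> smooth_algebra g
| AlgCst (a : R) : smooth_algebra (fun=> a)
| AlgCoord l m : smooth_algebra (horizontal_coord l m)
| AlgAdd g h : smooth_algebra g -> smooth_algebra h -> smooth_algebra (g \+ h)
| AlgMul g h : smooth_algebra g -> smooth_algebra h -> smooth_algebra (g \* h).

Lemma smooth_algebra_continuous g x :
  smooth_algebra g -> Om x -> {for x, continuous g}.
Proof.
move=> + Omx; elim=> {g} [g sg|a|l m|g h _ cg _ ch|g h _ cg _ ch].
- exact: smooth_continuous.
- exact: cst_continuous.
- exact: continuous_coord.
- exact: continuousD.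
- exact: continuousM.
Qed.

Lemma smooth_algebra_derivable g c x :
  smooth_algebra g -> Om x -> derivable g x (unit_vec R c).
Proof.
move=> + Omx; elim=> {g} [g sg|a|l m|g h _ cg _ ch|g h _ cg _ ch].
- exact: smooth_derivable.
- exact: derivable_cst.
- by have [] := is_derive_coord l m x (unit_vec R c).
- exact: (derivableD cg ch).
- exact: (derivableM cg ch).
Qed.

Lemma smooth_algebra_derive g c : smooth_algebra g ->
  exists2 h, smooth_algebra h & forall x, Om x -> 'D_(unit_vec R c) g x = h x.
Proof.
elim=> {g} [g sg|a|l m|g h pg [g' pg' gE] ph [h' ph' hE]
  |g h pg [g' pg' gE] ph [h' ph' hE]].
- by exists (fun x => 'D_(unit_vec R c) g x) => //; apply/AlgSmooth/smooth_derive.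
- by exists (fun=> 0 : R); [apply: AlgCst | move=> x _; apply: derive_cst].
- exists (fun=> (unit_vec R c).1 l m); first exact: AlgCst.
  by move=> x _; apply/derive_val/is_derive_coord.
- exists (g' \+ h'); first exact: AlgAdd.
  by move=> x Omx; rewrite deriveD ?gE ?hE//; apply: smooth_algebra_derivable.
- exists ((g \* h') \+ (h \* g')); first by apply: AlgAdd; apply: AlgMul.
  by move=> x Omx; rewrite deriveM ?gE ?hE//; apply: smooth_algebra_derivable.
Qed.

(** Peeling derivatives off at the end of the list, next to the function,
keeps the function inside [smooth_algebra]. *)
Lemma smooth_of_algebra g : smooth_algebra g -> smooth_on Om g.
Proof.
move=> pg s; elim/last_ind: s g pg => [|s c IH] g pg x Omx.
  by split=> [|c]; [apply: smooth_algebra_continuous | apply: smooth_algebra_derivable].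
have [h ph gh] := smooth_algebra_derive c pg.
have E y (Omy : Om y) := iter_partial_eq_on s gh Omy.
rewrite /iter_partial foldr_rcons -/(iter_partial _ _).
have [ch dh] := IH h ph x Omx; split=> [|c'].
  by apply: (continuous_eq_on oOm _ Omx ch) => y Omy; rewrite -E.
by apply: (derivable_eq_on oOm _ Omx (dh c')) => y Omy; rewrite -E.
Qed.

Lemma smooth_eq_on g h :
  (forall y, Om y -> g y = h y) -> smooth_on Om g -> smooth_on Om h.
Proof.
move=> gh sg s x Omx; have [cg dg] := sg s x Omx; split=> [|c].
  by apply: (continuous_eq_on oOm _ Omx cg) => y; apply: iter_partial_eq_on.
by apply: (derivable_eq_on oOm _ Omx (dg c)) => y; apply: iter_partial_eq_on.
Qed.

Lemma smooth_add g h :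
  smooth_on Om g -> smooth_on Om h -> smooth_on Om (fun x => g x + h x).
Proof.
by move=> sg sh; apply: smooth_of_algebra; apply: AlgAdd; apply: AlgSmooth.
Qed.

Lemma smooth_mul g h :
  smooth_on Om g -> smooth_on Om h -> smooth_on Om (fun x => g x * h x).
Proof.
by move=> sg sh; apply: smooth_of_algebra; apply: AlgMul; apply: AlgSmooth.
Qed.

Lemma smooth_cst (a : R) : smooth_on Om (fun=> a).
Proof. exact/smooth_of_algebra/AlgCst. Qed.

Lemma smooth_coord l m : smooth_on Om (horizontal_coord l m).
Proof. exact/smooth_of_algebra/AlgCoord. Qed.

Lemma partial_comm g c d x : smooth_on Om g -> Om x ->
  'D_(unit_vec R d) ('D_(unit_vec R c) g) x =
  'D_(unit_vec R c) ('D_(unit_vec R d) g) x.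
Proof.
move=> sg Omx; apply: (derive_comm oOm Omx).
- by move=> y; apply: smooth_derivable.
- by move=> y; apply: smooth_derivable.
- by move=> y; apply: smooth_derivable; apply: smooth_derive.
- by move=> y; apply: smooth_derivable; apply: smooth_derive.
- by apply: smooth_continuous Omx; do 2! apply: smooth_derive.
- by apply: smooth_continuous Omx; do 2! apply: smooth_derive.
Qed.

Lemma smooth_deriveD g h c x : smooth_on Om g -> smooth_on Om h -> Om x ->
  'D_(unit_vec R c) (fun y => g y + h y) x =
  'D_(unit_vec R c) g x + 'D_(unit_vec R c) h x.
Proof. by move=> sg sh Omx; apply: deriveD; apply: smooth_derivable. Qed.

Lemma smooth_deriveM g h c x : smooth_on Om g -> smooth_on Om h -> Om x ->
  'D_(unit_vec R c) (fun y => g y * h y) x =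
  g x * 'D_(unit_vec R c) h x + h x * 'D_(unit_vec R c) g x.
Proof. by move=> sg sh Omx; apply: deriveM; apply: smooth_derivable. Qed.

Lemma smooth_sub g h :
  smooth_on Om g -> smooth_on Om h -> smooth_on Om (fun x => g x - h x).
Proof.
move=> sg sh; have := smooth_add sg (smooth_mul (smooth_cst (-1)) sh).
by apply: smooth_eq_on => y _; rewrite mulN1r.
Qed.

Lemma smooth_deriveB g h c x : smooth_on Om g -> smooth_on Om h -> Om x ->
  'D_(unit_vec R c) (fun y => g y - h y) x =
  'D_(unit_vec R c) g x - 'D_(unit_vec R c) h x.
Proof. by move=> sg sh Omx; apply: deriveB; apply: smooth_derivable. Qed.

Definition csmooth (g : heis R n -> R[i]) : Prop :=
  smooth_on Om (fun x => complex.Re (g x)) /\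
  smooth_on Om (fun x => complex.Im (g x)).

Implicit Types (G H : heis R n -> R[i]).

Lemma ReD (a b : R[i]) : complex.Re (a + b) = complex.Re a + complex.Re b.
Proof. by case: a; case: b. Qed.
Lemma ImD (a b : R[i]) : complex.Im (a + b) = complex.Im a + complex.Im b.
Proof. by case: a; case: b. Qed.
Lemma ReM (a b : R[i]) : complex.Re (a * b) =
  complex.Re a * complex.Re b - complex.Im a * complex.Im b.
Proof. by case: a; case: b. Qed.
Lemma ImM (a b : R[i]) : complex.Im (a * b) =
  complex.Re a * complex.Im b + complex.Im a * complex.Re b.
Proof. by case: a; case: b. Qed.

Lemma csmooth_eq_on G H :
  (forall y, Om y -> G y = H y) -> csmooth G -> csmooth H.
Proof.
by move=> GH [rG iG]; split; [apply: smooth_eq_on rG|apply: smooth_eq_on iG];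
  move=> y /GH ->.
Qed.

Lemma csmooth_add G H : csmooth G -> csmooth H -> csmooth (fun x => G x + H x).
Proof.
move=> [rG iG] [rH iH]; split.
  by under boolp.eq_fun do rewrite ReD; apply: smooth_add.
by under boolp.eq_fun do rewrite ImD; apply: smooth_add.
Qed.

Lemma csmooth_cst (a : R[i]) : csmooth (fun=> a).
Proof. by split; apply: smooth_cst. Qed.

Lemma csmooth_mul G H : csmooth G -> csmooth H -> csmooth (fun x => G x * H x).
Proof.
move=> [rG iG] [rH iH]; split.
  by under boolp.eq_fun do rewrite ReM; apply: smooth_sub; apply: smooth_mul.
by under boolp.eq_fun do rewrite ImM; apply: smooth_add; apply: smooth_mul.
Qed.

Lemma csmooth_coord l m : csmooth (fun x => (horizontal_coord l m x)%:C).
Proof. by split => /=; [apply: smooth_coord | apply: smooth_cst]. Qed.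

Lemma csmooth_sum (I : Type) (r : seq I) (F : I -> heis R n -> R[i]) :
  (forall i, csmooth (F i)) -> csmooth (fun x => \sum_(i <- r) F i x).
Proof.
move=> sF; elim: r => [|i r IH].
  have -> : (fun x => \sum_(j <- [::]) F j x) = (fun=> 0).
    by apply: boolp.funext => x; rewrite big_nil.
  exact: csmooth_cst.
have -> : (fun x => \sum_(j <- i :: r) F j x) =
    (fun x => F i x + \sum_(j <- r) F j x).
  by apply: boolp.funext => x; rewrite big_cons.
exact: (csmooth_add (sF i) IH).
Qed.

Lemma csmooth_partialC c G : csmooth G -> csmooth (partialC c G).
Proof. by move=> [rG iG]; split; apply: smooth_derive. Qed.

Lemma partialC_eq_on c G H x :
  (forall y, Om y -> G y = H y) -> Om x -> partialC c G x = partialC c H x.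
Proof.
by move=> GH Omx; congr (_ +i* _); apply: (derive_eq_on _ oOm _ Omx) => y /GH ->.
Qed.

Lemma partialCD c G H x : csmooth G -> csmooth H -> Om x ->
  partialC c (fun y => G y + H y) x = partialC c G x + partialC c H x.
Proof.
move=> [rG iG] [rH iH] Omx; rewrite /partialC.
have -> : (fun y => complex.Re (G y + H y)) =
    (fun y => complex.Re (G y) + complex.Re (H y)).
  by apply: boolp.funext => y; rewrite ReD.
have -> : (fun y => complex.Im (G y + H y)) =
    (fun y => complex.Im (G y) + complex.Im (H y)).
  by apply: boolp.funext => y; rewrite ImD.
by rewrite (smooth_deriveD c rG rH Omx) (smooth_deriveD c iG iH Omx).
Qed.

Lemma partialCM c G H x : csmooth G -> csmooth H -> Om x ->
  partialC c (fun y => G y * H y) x =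
  G x * partialC c H x + partialC c G x * H x.
Proof.
move=> [rG iG] [rH iH] Omx; rewrite /partialC.
have -> : (fun y => complex.Re (G y * H y)) =
    (fun y => complex.Re (G y) * complex.Re (H y) - complex.Im (G y) * complex.Im (H y)).
  by apply: boolp.funext => y; rewrite ReM.
have -> : (fun y => complex.Im (G y * H y)) =
    (fun y => complex.Re (G y) * complex.Im (H y) + complex.Im (G y) * complex.Re (H y)).
  by apply: boolp.funext => y; rewrite ImM.
have sM g h := @smooth_mul g h.
rewrite (smooth_deriveB c (sM _ _ rG rH) (sM _ _ iG iH) Omx).
rewrite (smooth_deriveD c (sM _ _ rG iH) (sM _ _ iG rH) Omx).
rewrite (smooth_deriveM c rG rH Omx) (smooth_deriveM c iG iH Omx).
rewrite (smooth_deriveM c rG iH Omx) (smooth_deriveM c iG rH Omx).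
case: (G x) => a b; case: (H x) => a' b'.
apply/eqP; rewrite eq_complex /=.
by apply/andP; split; apply/eqP; rewrite /GRing.scale /=; ring.
Qed.

Lemma partialC_cst c (a : R[i]) x : partialC c (fun=> a) x = 0.
Proof. by rewrite /partialC !derive_cst. Qed.

Lemma partialC_coord c l m x :
  partialC c (fun y => (horizontal_coord l m y)%:C) x = ((unit_vec R c).1 l m)%:C.
Proof.
by rewrite /partialC /= derive_cst; congr (_ +i* _); apply/derive_val/is_derive_coord.
Qed.

Lemma partialC_comm c d G x : csmooth G -> Om x ->
  partialC c (partialC d G) x = partialC d (partialC c G) x.
Proof.
move=> [rG iG] Omx.
exact: (f_equal2 (@Complex R) (partial_comm d c rG Omx) (partial_comm d c iG Omx)).
Qed.

End Smooth.

(** * Commutation relations of the left invariant vector fields *)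

(** The bilinear form of the matrix [B^c], written out so that the identity
below becomes a polynomial identity in the entries. *)
Definition matB_form (R : realType) (u v : seq R[i]) (c : 'I_3) : R[i] :=
  match val c with
  | 0%N => - u`_0 * v`_1 + u`_1 * v`_0 - u`_2 * v`_3 + u`_3 * v`_2
  | 1%N => - u`_0 * v`_2 + u`_1 * v`_3 + u`_2 * v`_0 - u`_3 * v`_1
  | _   => - u`_0 * v`_3 - u`_1 * v`_2 + u`_2 * v`_1 + u`_3 * v`_0
  end.

Lemma matB_formE (R : realType) (u v : seq R[i]) c :
  \sum_(j < 4) \sum_(j' < 4) u`_j * v`_j' * (matB R c j j')%:C = matB_form u v c.
Proof.
rewrite !big_ord_recl !big_ord0 /= /bump /= !add1n.
rewrite /matB_form; case: c => [[|[|[|//]]] c3] /=; rewrite !mxE /=.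
all: rewrite ?rmorphN ?rmorph1 ?rmorph0; ring.
Qed.

(** The coefficients of [Y_{4l+1}, ..., Y_{4l+4}] in [Z_A^a], as functions of
the parity [o] of [A] and of whether [a] is 0'. *)
Definition zcoef (R : realType) (o e : bool) : seq R[i] :=
  match o, e with
  | false, true  => [:: 0; 0; -1; - 'i%R]
  | false, false => [:: -1; - 'i%R; 0; 0]
  | true,  true  => [:: 1; - 'i%R; 0; 0]
  | true,  false => [:: 0; 0; -1; 'i%R]
  end.

(** A finite check over the parities of the two unprimed indices, modulo
[i ^ 2 = -1]. *)
Lemma matB_form_zcoef_sym (R : realType) (o o' e e' : bool) c :
  matB_form (zcoef R o e) (zcoef R o' e') c +
  matB_form (zcoef R o e') (zcoef R o' e) c = 0.
Proof.
have: 'i%R * 'i%R = -1 :> R[i] by rewrite -expr2 sqrCi.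
rewrite /zcoef /matB_form; move: ('i%R) => I I2.
by case: c => [[|[|[|//]]] c3] /=; case: o; case: o'; case: e; case: e' => /=;
  rewrite ?(mulrN, mulNr, opprK) ?I2; ring.
Qed.

Section Fields.
Context {R : realType} {n : nat} {Om : set (heis R n)}.
Hypothesis oOm : open Om.
Implicit Types (G H : heis R n -> R[i]) (x : heis R n).
Local Notation csmooth := (csmooth (Om := Om)).

Lemma partialC_sum c (I : Type) (r : seq I) (F : I -> heis R n -> R[i]) x :
  (forall i, csmooth (F i)) -> Om x ->
  partialC c (fun y => \sum_(i <- r) F i y) x = \sum_(i <- r) partialC c (F i) x.
Proof.
move=> sF Omx; elim: r => [|i r IH].
  have -> : (fun y => \sum_(i <- [::]) F i y) = (fun=> 0).
    by apply: boolp.funext => y; rewrite big_nil.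
  by rewrite partialC_cst big_nil.
rewrite big_cons -IH -(partialCD c (sF i) (csmooth_sum oOm r sF) Omx).
congr (partialC c _ x).
by apply: boolp.funext => y; rewrite big_cons.
Qed.

(** The coefficient of d/ds_b in Y_{4l+j}. *)
Definition vcoef (l : 'I_n) (j : 'I_4) (b : 'I_3) x : R[i] :=
  2 * \sum_(m < 4) (matB R b m j)%:C * (horizontal_coord l m x)%:C.

Lemma fieldYE l j G x :
  fieldY l j G x =
  partialC (inl (l, j)) G x + \sum_(b < 3) vcoef l j b x * partialC (inr b) G x.
Proof.
rewrite /fieldY mulr_sumr; congr (_ + _); apply: eq_bigr => b _.
rewrite -mulrA mulr_suml; congr (_ * _); apply: eq_bigr => m _.
by rewrite rmorphM.
Qed.

Lemma csmooth_vcoef l j b : csmooth (vcoef l j b).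
Proof.
apply: (csmooth_mul oOm); first exact: (csmooth_cst oOm).
apply: (csmooth_sum oOm) => m; apply: (csmooth_mul oOm).
  exact: (csmooth_cst oOm).
exact: (csmooth_coord oOm).
Qed.

Lemma partialC_vcoef c l j b x : Om x ->
  partialC c (vcoef l j b) x =
  2 * \sum_(m < 4) (matB R b m j)%:C * ((unit_vec R c).1 l m)%:C.
Proof.
move=> Omx.
have sB m : csmooth (fun y => (matB R b m j)%:C * (horizontal_coord l m y)%:C).
  exact: (csmooth_mul oOm (csmooth_cst oOm _) (csmooth_coord oOm l m)).
rewrite (partialCM oOm c (csmooth_cst oOm 2) (csmooth_sum oOm _ sB) Omx).
rewrite partialC_cst mul0r addr0 (partialC_sum _ _ sB Omx); congr (_ * _).
apply: eq_bigr => m _.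
rewrite (partialCM oOm c (csmooth_cst oOm _) (csmooth_coord oOm l m) Omx).
by rewrite partialC_cst mul0r addr0 partialC_coord.
Qed.

Lemma fieldY_eq_on l j G H x :
  (forall y, Om y -> G y = H y) -> Om x -> fieldY l j G x = fieldY l j H x.
Proof.
move=> GH Omx; rewrite !fieldYE (partialC_eq_on oOm _ GH Omx).
by congr (_ + _); apply: eq_bigr => b _; rewrite (partialC_eq_on oOm _ GH Omx).
Qed.

Lemma csmooth_fieldY l j G : csmooth G -> csmooth (fieldY l j G).
Proof.
move=> sG; have -> : fieldY l j G = (fun x => partialC (inl (l, j)) G x +
    \sum_(b < 3) vcoef l j b x * partialC (inr b) G x).
  by apply: boolp.funext => x; rewrite fieldYE.
apply: (csmooth_add oOm); first exact: csmooth_partialC.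
apply: (csmooth_sum oOm) => b; apply: (csmooth_mul oOm (csmooth_vcoef l j b)).
exact: csmooth_partialC.
Qed.

Lemma fieldYD l j G H x : csmooth G -> csmooth H -> Om x ->
  fieldY l j (fun y => G y + H y) x = fieldY l j G x + fieldY l j H x.
Proof.
move=> sG sH Omx; rewrite !fieldYE (partialCD _ sG sH Omx) addrACA -big_split /=.
by congr (_ + _); apply: eq_bigr => b _; rewrite (partialCD _ sG sH Omx) mulrDr.
Qed.

Lemma fieldYM l j G H x : csmooth G -> csmooth H -> Om x ->
  fieldY l j (fun y => G y * H y) x = G x * fieldY l j H x + fieldY l j G x * H x.
Proof.
move=> sG sH Omx; rewrite !fieldYE (partialCM oOm _ sG sH Omx).
rewrite mulrDr mulrDl addrACA mulr_sumr mulr_suml -big_split /=.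
congr (_ + _); apply: eq_bigr => b _; rewrite (partialCM oOm _ sG sH Omx).
ring.
Qed.

Lemma fieldY_cst l j (a : R[i]) x : fieldY l j (fun=> a) x = 0.
Proof.
rewrite fieldYE partialC_cst add0r big1// => b _.
by rewrite partialC_cst mulr0.
Qed.

Lemma fieldY_sum l j (I : Type) (r : seq I) (F : I -> heis R n -> R[i]) x :
  (forall i, csmooth (F i)) -> Om x ->
  fieldY l j (fun y => \sum_(i <- r) F i y) x = \sum_(i <- r) fieldY l j (F i) x.
Proof.
move=> sF Omx; elim: r => [|i r IH].
  have -> : (fun y => \sum_(i <- [::]) F i y) = (fun=> 0).
    by apply: boolp.funext => y; rewrite big_nil.
  by rewrite fieldY_cst big_nil.
rewrite big_cons -IH -(fieldYD l j (sF i) (csmooth_sum oOm r sF) Omx).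
congr (fieldY l j _ x).
by apply: boolp.funext => y; rewrite big_cons.
Qed.

(** Coordinate derivatives commute with [Y] except for the term where they
hit the coefficients of [Y]. *)
Lemma partialC_fieldY c l j G x : csmooth G -> Om x ->
  partialC c (fieldY l j G) x = fieldY l j (partialC c G) x +
    \sum_(b < 3) partialC c (vcoef l j b) x * partialC (inr b) G x.
Proof.
move=> sG Omx.
have -> : fieldY l j G = (fun x => partialC (inl (l, j)) G x +
    \sum_(b < 3) vcoef l j b x * partialC (inr b) G x).
  by apply: boolp.funext => y; rewrite fieldYE.
have sT b := csmooth_mul oOm (csmooth_vcoef l j b) (csmooth_partialC (inr b) sG).
rewrite (partialCD c (csmooth_partialC _ sG) (csmooth_sum oOm _ sT) Omx).
rewrite (partialC_sum c _ sT Omx) fieldYE (partialC_comm oOm c _ sG Omx).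
rewrite -addrA -big_split /=; congr (_ + _); apply: eq_bigr => b _.
rewrite (partialCM oOm c (csmooth_vcoef l j b) (csmooth_partialC (inr b) sG) Omx).
by rewrite (partialC_comm oOm c _ sG Omx).
Qed.

Lemma partialC_vcoef_vert b' l j b x : Om x -> partialC (inr b') (vcoef l j b) x = 0.
Proof.
move=> Omx; rewrite partialC_vcoef// big1 ?mulr0// => m _.
by rewrite [X in _ * X%:C]mxE rmorph0 mulr0.
Qed.

Lemma partialC_vcoef_hor l' j' l j b x : Om x ->
  partialC (inl (l', j')) (vcoef l j b) x = (l == l')%:R * 2 * (matB R b j' j)%:C.
Proof.
move=> Omx; rewrite partialC_vcoef// (bigD1 j') //= big1 => [|m mj].
  rewrite [X in _ * X%:C]mxE eqxx andbT addr0 rmorph_nat; ring.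
by rewrite [X in _ * X%:C]mxE (negPf mj) andbF rmorph0 mulr0.
Qed.

Lemma fieldY_vcoef l' j' l j b x : Om x ->
  fieldY l' j' (vcoef l j b) x = (l == l')%:R * 2 * (matB R b j' j)%:C.
Proof.
move=> Omx; rewrite fieldYE partialC_vcoef_hor// big1 ?addr0// => b' _.
by rewrite partialC_vcoef_vert// mulr0.
Qed.

Lemma matB_anti b i j : matB R b i j = - matB R b j i.
Proof.
rewrite !mxE; case: b => [[|[|[|//]]] ?]; case: i => [[|[|[|[|//]]]] ?];
  by case: j => [[|[|[|[|//]]]] ?] /=; rewrite ?oppr0 ?opprK.
Qed.

(** The coefficients of [Y] do not depend on [s], so the vertical derivatives
commute with both fields and only the horizontal derivatives of the coefficients
survive; the antisymmetry of [B^b] makes the two contributions equal. *)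
Lemma fieldY_comm l j l' j' G x : csmooth G -> Om x ->
  fieldY l j (fieldY l' j' G) x = fieldY l' j' (fieldY l j G) x +
  \sum_(b < 3) (l == l')%:R * 4 * (matB R b j j')%:C * partialC (inr b) G x.
Proof.
move=> sG Omx; rewrite fieldYE partialC_fieldY//.
have sT b := csmooth_mul oOm (csmooth_vcoef l j b) (csmooth_partialC (inr b) sG).
have -> : fieldY l j G = (fun x => partialC (inl (l, j)) G x +
    \sum_(b < 3) vcoef l j b x * partialC (inr b) G x).
  by apply: boolp.funext => y; rewrite fieldYE.
rewrite (fieldYD l' j' (csmooth_partialC _ sG) (csmooth_sum oOm _ sT) Omx).
rewrite (fieldY_sum l' j' _ sT Omx).
set Y0 := fieldY l' j' (partialC _ G) x.
rewrite -[LHS]addrA -[RHS]addrA; apply: (congr1 (fun z => Y0 + z)).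
rewrite -!big_split /=.
apply: eq_bigr => b _; rewrite partialC_vcoef_hor// partialC_fieldY//.
rewrite big1 ?addr0; last first.
  by move=> b' _; rewrite partialC_vcoef_vert// mul0r.
rewrite (fieldYM l' j' (csmooth_vcoef l j b) (csmooth_partialC (inr b) sG) Omx).
rewrite fieldY_vcoef// (matB_anti b j' j) eq_sym rmorphN /=.
ring.
Qed.

Local Notation zeta A a := (zcoef R (odd A) (a == ord0)).

Lemma fieldZE A a G x :
  fieldZ A a G x = \sum_(j < 4) (zeta A a)`_j * fieldY (half_index A) j G x.
Proof.
rewrite !big_ord_recl big_ord0 /fieldZ /zcoef.
have -> : @Ordinal 4 0 isT = ord0 by apply: val_inj.
have -> : @Ordinal 4 1 isT = lift ord0 ord0 by apply: val_inj.
have -> : @Ordinal 4 2 isT = lift ord0 (lift ord0 ord0) by apply: val_inj.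
have -> : @Ordinal 4 3 isT = lift ord0 (lift ord0 (lift ord0 ord0)) by apply: val_inj.
move: (fieldY _ ord0 G x) (fieldY _ (lift ord0 ord0) G x) => Y1 Y2.
move: (fieldY _ (lift ord0 (lift ord0 ord0)) G x) => Y3.
move: (fieldY _ (lift ord0 (lift ord0 (lift ord0 ord0))) G x) => Y4.
by case: (odd A); case: (a == ord0) => /=; ring.
Qed.

Lemma fieldZ_eq_on A a G H x :
  (forall y, Om y -> G y = H y) -> Om x -> fieldZ A a G x = fieldZ A a H x.
Proof.
by move=> GH Omx; rewrite !fieldZE; apply: eq_bigr => j _;
  rewrite (fieldY_eq_on _ _ GH Omx).
Qed.

Lemma csmooth_fieldZ A a G : csmooth G -> csmooth (fieldZ A a G).
Proof.
move=> sG; have -> : fieldZ A a G = (fun x => \sum_(j < 4) (zeta A a)`_j *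
    fieldY (half_index A) j G x) by apply: boolp.funext => x; rewrite fieldZE.
apply: (csmooth_sum oOm) => j.
exact: (csmooth_mul oOm (csmooth_cst oOm _) (csmooth_fieldY _ _ sG)).
Qed.

Lemma fieldZ_sum A a (I : Type) (r : seq I) (c : I -> R[i])
    (F : I -> heis R n -> R[i]) x :
  (forall i, csmooth (F i)) -> Om x ->
  fieldZ A a (fun y => \sum_(i <- r) c i * F i y) x =
  \sum_(i <- r) c i * fieldZ A a (F i) x.
Proof.
move=> sF Omx.
have scF i := csmooth_mul oOm (csmooth_cst oOm (c i)) (sF i).
rewrite fieldZE; under eq_bigr do rewrite (fieldY_sum _ _ _ scF Omx) mulr_sumr.
rewrite exchange_big /=; apply: eq_bigr => i _; rewrite fieldZE mulr_sumr.
apply: eq_bigr => j _; rewrite (fieldYM _ _ (csmooth_cst oOm (c i)) (sF i) Omx).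
by rewrite fieldY_cst mul0r addr0 mulrCA.
Qed.

Lemma fieldZ_fieldZ A a B b G x : csmooth G -> Om x ->
  fieldZ A a (fieldZ B b G) x = fieldZ B b (fieldZ A a G) x +
  \sum_(c < 3) (half_index A == half_index B)%:R * 4 * matB_form (zeta A a) (zeta B b) c
      * partialC (inr c) G x.
Proof.
have E A' a' B' b' : csmooth G -> Om x -> fieldZ A' a' (fieldZ B' b' G) x =
    \sum_(j < 4) \sum_(j' < 4) (zeta A' a')`_j * (zeta B' b')`_j' *
       fieldY (half_index A') j (fieldY (half_index B') j' G) x.
  move=> sG Omx; rewrite fieldZE; apply: eq_bigr => j _.
  have -> : fieldZ B' b' G = (fun x => \sum_(j' < 4) (zeta B' b')`_j' *
    fieldY (half_index B') j' G x) by apply: boolp.funext => y; rewrite fieldZE.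
  have sF j' := csmooth_fieldY (half_index B') j' sG.
  have scF (j' : 'I_4) := csmooth_mul oOm (csmooth_cst oOm ((zeta B' b')`_j')) (sF j').
  rewrite (fieldY_sum _ _ _ scF Omx) mulr_sumr; apply: eq_bigr => j' _.
  rewrite (fieldYM _ _ (csmooth_cst oOm _) (sF j') Omx) fieldY_cst mul0r addr0.
  by rewrite mulrA.
move=> sG Omx; set K := _%:R * 4.
transitivity (\sum_(j < 4) \sum_(j' < 4)
    ((zeta B b)`_j' * (zeta A a)`_j *
       fieldY (half_index B) j' (fieldY (half_index A) j G) x +
     \sum_(c < 3) K * ((zeta A a)`_j * (zeta B b)`_j' * (matB R c j j')%:C) *
       partialC (inr c) G x)).
  rewrite E//; apply: eq_bigr => j _; apply: eq_bigr => j' _.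
  rewrite (fieldY_comm _ _ _ _ sG Omx) mulrDr [_`_j' * _`_j]mulrC.
  congr (_ + _); rewrite mulr_sumr; apply: eq_bigr => c _.
  rewrite /K; move: (partialC _ _ _) => T; ring.
under eq_bigr => j _ do rewrite big_split.
rewrite big_split E// [in RHS]exchange_big /=; congr (_ + _).
rewrite exchange_big; under eq_bigr => j' _ do rewrite exchange_big.
rewrite exchange_big; apply: eq_bigr => c _.
rewrite -matB_formE mulr_sumr mulr_suml exchange_big; apply: eq_bigr => j _.
by rewrite mulr_sumr mulr_suml.
Qed.

(** The vertical derivatives come with [matB_form] of the coefficients, whose
sum over the exchange of the primed indices vanishes.  The identity is written
so that its sides are exchanged by [A <-> B]: its left-hand side, antisymmetrised
in [A] and [B], is zero. *)
Lemma fieldZ_anticomm A a B b G x : csmooth G -> Om x ->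
  fieldZ A a (fieldZ B b G) x + fieldZ A b (fieldZ B a G) x =
  fieldZ B b (fieldZ A a G) x + fieldZ B a (fieldZ A b G) x.
Proof.
move=> sG Omx; rewrite (fieldZ_fieldZ A a)// (fieldZ_fieldZ A b)// addrACA.
rewrite -big_split big1 ?addr0//= => c _.
by rewrite -mulrDl -mulrDr matB_form_zcoef_sym mulr0 mul0r.
Qed.

End Fields.

(** * Averages over permutations *)

Section Averages.
Context {R : realType} {T : Type}.
Implicit Types (F G : seq T -> R[i]).

(** The sign character of the symmetric group for [e = true], and the trivial
one for [e = false]: antisymmetrisation and symmetrisation are treated together. *)
Definition twist (e : bool) m (s : 'S_m) : R[i] := (-1) ^+ (e && s).

Definition avg (e : bool) F (t : seq T) : R[i] :=
  ((size t)`!%:R)^-1 * \sum_(s : 'S_(size t)) twist e s * F (permute s (in_tuple t)).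

(** An average is a finite linear combination with constant coefficients, so
it commutes with every linear operator. *)
Lemma avg_comb e F t :
  avg e F t = \sum_(s : 'S_(size t))
    (((size t)`!%:R)^-1 * twist e s) * F (permute s (in_tuple t)).
Proof. by rewrite /avg mulr_sumr; apply: eq_bigr => s _; rewrite mulrA. Qed.

(** The two sums range over ['S_(size t)] and ['S_m], which are provably but not
syntactically the same type. *)
Lemma avgE e F m (t : m.-tuple T) :
  avg e F t = (m`!%:R)^-1 * \sum_(s : 'S_m) twist e s * F (permute s t).
Proof.
case: t => t tm /=; have := tm; rewrite /avg; move: (eqP tm) => E.
by case: m / E tm => tm tm'; rewrite (_ : in_tuple t = Tuple tm) //; apply: val_inj.
Qed.

Lemma alt_avg F m (t : m.-tuple T) : alt F t = avg true F t.
Proof. by rewrite avgE. Qed.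

Lemma sym_avg F m (t : m.-tuple T) : sym F t = avg false F t.
Proof.
by rewrite avgE; congr (_ * _); apply: eq_bigr => s _; rewrite /twist mul1r.
Qed.

Lemma twistM e m (s u : 'S_m) : twist e (s * u)%g = twist e s * twist e u.
Proof. by rewrite /twist odd_permM; case: e => /=; rewrite ?mulr1// signr_addb. Qed.

Lemma twistV e m (s : 'S_m) : twist e s^-1%g = twist e s.
Proof. by rewrite /twist odd_permV. Qed.

Lemma twist_sqr e m (s : 'S_m) : twist e s * twist e s = 1.
Proof. by rewrite -twistM /twist odd_permM addbb andbF. Qed.

Lemma permute_permute m (s u : 'S_m) (t : m.-tuple T) :
  permute u (permute s t) = permute (u * s)%g t.
Proof. by apply: eq_from_tnth => i; rewrite !tnth_mktuple permM. Qed.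

Lemma avg_permute e F m (s : 'S_m) (t : m.-tuple T) :
  avg e F (permute s t) = twist e s * avg e F t.
Proof.
rewrite !avgE mulrCA; congr (_ * _).
rewrite (reindex_inj (mulIg s^-1%g)) mulr_sumr; apply: eq_bigr => u _.
by rewrite permute_permute mulgKV twistM twistV mulrA [twist e s * _]mulrC.
Qed.

Lemma avg_ext e F G (t : seq T) :
  (forall u, size u = size t -> F u = G u) -> avg e F t = avg e G t.
Proof.
move=> FG; congr (_ * _); apply: eq_bigr => s _; congr (_ * _); apply: FG.
by rewrite size_tuple.
Qed.

Lemma avg_sum (I : Type) (r : seq I) e (c : I -> R[i]) (F : I -> seq T -> R[i]) t :
  avg e (fun u => \sum_(i <- r) c i * F i u) t = \sum_(i <- r) c i * avg e (F i) t.
Proof.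
rewrite /avg; under eq_bigr do rewrite mulr_sumr.
rewrite exchange_big mulr_sumr /=; apply: eq_bigr => i _.
rewrite mulrCA !mulr_sumr; apply: eq_bigr => s _; congr (_ * _).
by rewrite mulrCA.
Qed.

Lemma avg_scale e (c : R[i]) F t : avg e (fun u => c * F u) t = c * avg e F t.
Proof.
by rewrite !avg_comb mulr_sumr; apply: eq_bigr => s _; rewrite mulrCA.
Qed.

Lemma avg0 e (t : seq T) : avg e (fun=> 0) t = 0.
Proof. by rewrite avg_comb big1// => s _; rewrite mulr0. Qed.

Lemma avgD e F G t : avg e (fun u => F u + G u) t = avg e F t + avg e G t.
Proof.
by rewrite !avg_comb -big_split; apply: eq_bigr => s _; rewrite mulrDr.
Qed.

(** Exchanging the first two entries multiplies the average by its character
and, by hypothesis, by the opposite of it. *)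
Lemma avg_swap0 (e : bool) F (t : seq T) : (1 < size t)%N ->
  (forall a b u, F [:: b, a & u] = - (-1) ^+ e * F [:: a, b & u]) ->
  avg e F t = 0.
Proof.
case: t => [|t0 [|t1 t]] // _ Fswap; set n := size t.
pose w := in_tuple [:: t0, t1 & t].
pose i1 : 'I_n.+2 := lift ord0 ord0.
pose tau : 'S_n.+2 := tperm ord0 i1.
have twist_tau : twist e tau = (-1) ^+ e by rewrite /twist odd_tperm andbT.
have Ftau s : F (permute tau (permute s w)) = - twist e tau * F (permute s w).
  case/tupleP: (permute s w) => a v; case/tupleP: v => b v.
  rewrite twist_tau -Fswap; congr F.
  rewrite -[RHS]/(val [tuple of [:: b, a & v]]); congr val.
  apply: eq_from_tnth => i; rewrite tnth_mktuple.
  have [->|i0] := eqVneq i ord0; first by rewrite tpermL.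
  have [->|ii1] := eqVneq i i1; first by rewrite tpermR.
  rewrite tpermD 1?eq_sym//.
  case: (unliftP ord0 i) i0 ii1 => [j ->|->]; last by rewrite eqxx.
  case: (unliftP ord0 j) => [k ->|->]; last by rewrite eqxx.
  by move=> _ _; rewrite !tnthS.
have E : avg e F w = - avg e F w.
  rewrite !avgE -mulrN; congr (_ * _).
  rewrite [LHS](reindex_inj (mulgI tau)) -sumrN; apply: eq_bigr => s _.
  by rewrite twistM -permute_permute Ftau mulNr mulrN mulrACA twist_sqr mul1r.
apply/eqP; move/eqP: E; rewrite -subr_eq0 opprK -mulr2n mulrn_eq0 /=.
by [].
Qed.

(** The shape in which [opD] consumes an index, with the same value 0 at the
empty list. *)
Definition on_cons (H : T -> seq T -> R[i]) (t : seq T) : R[i] :=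
  if t is b :: t' then H b t' else 0.

(** A permutation of the tail is a permutation of the whole list that fixes the
head; for each of them the outer average merely reindexes its sum. *)
Lemma avg_absorb e (H : T -> seq T -> R[i]) t :
  avg e (on_cons (fun b => avg e (H b))) t = avg e (on_cons H) t.
Proof.
case: t => [|t0 t].
  by apply: avg_ext => -[].
set n := size t; pose w := in_tuple (t0 :: t).
have lift_cons (u : 'S_n) (v : n.+1.-tuple T) :
    permute (lift_perm ord0 ord0 u) v = thead v :: permute u [tuple of behead v] :> seq T.
  case/tupleP: v => a v; rewrite theadE.
  rewrite -[RHS]/(val [tuple of a :: permute u [tuple of behead (a :: v)]]); congr val.
  apply: eq_from_tnth => i; rewrite tnth_mktuple.
  case: (unliftP ord0 i) => [j ->|->]; last by rewrite lift_perm_id.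
  rewrite lift_perm_lift !tnthS tnth_mktuple.
  by congr tnth; apply: val_inj.
(* Each of the [n`!] inner permutations contributes the full outer average. *)
transitivity ((n`!%:R)^-1 * \sum_(u : 'S_n) avg e (on_cons H) w); last first.
  rewrite sumr_const card_Sn -[X in _ * X]mulr_natl mulKf//.
  by rewrite pnatr_eq0 -lt0n fact_gt0.
rewrite -[LHS]/(avg e _ (val w)) avgE.
transitivity ((n.+1`!%:R)^-1 * \sum_(s : 'S_n.+1) ((n`!%:R)^-1 *
   \sum_(u : 'S_n) twist e (lift_perm ord0 ord0 u * s)%g *
      on_cons H (permute (lift_perm ord0 ord0 u * s)%g w))).
  congr (_ * _); apply: eq_bigr => s _.
  set v := permute s w.
  have -> : on_cons (fun b => avg e (H b)) v = avg e (H (thead v)) [tuple of behead v].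
    by case/tupleP: v => a v.
  rewrite avgE mulrCA mulr_sumr; congr (_ * _); apply: eq_bigr => u _.
  rewrite -permute_permute lift_cons twistM mulrA; congr (_ * _).
  by rewrite mulrC /twist odd_lift_perm.
rewrite -mulr_sumr mulrCA; congr (_ * _); rewrite exchange_big mulr_sumr.
apply: eq_bigr => u _; congr (_ * _).
by rewrite [RHS](reindex_inj (mulgI (lift_perm ord0 ord0 u))).
Qed.

End Averages.

Lemma avg_exchange (R : realType) (T U : Type) (e e' : bool)
    (M : seq T -> seq U -> R[i]) t u :
  avg e (fun A => avg e' (M A) u) t = avg e' (fun B => avg e (M^~ B) t) u.
Proof.
rewrite [RHS]avg_comb -avg_sum.
by apply: avg_ext => A _; rewrite avg_comb.
Qed.

(** * Anticommuting differentials on antisymmetrised forms *)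

Section Forms.
Context {R : realType} {n : nat} {Om : set (heis R n)}.
Hypothesis oOm : open Om.
Local Notation csmooth := (csmooth (Om := Om)).
Local Notation form := (heis R n -> seq 'I_(n.*2) -> R[i]).
Implicit Types (G H : form) (x : heis R n) (A B : seq 'I_(n.*2)).

Definition smooth_form G : Prop := forall B, csmooth (G^~ B).

(** The operator [G |-> \sum_b Z_b^a G e_b] of exterior multiplication, before
antisymmetrisation. *)
Definition dform (a : 'I_2) G : form :=
  fun x => on_cons (fun b B => fieldZ b a (G^~ B) x).

Definition alt_form G : form := fun x => avg true (G x).

Lemma smooth_dform a G : smooth_form G -> smooth_form (dform a G).
Proof.
move=> sG [|b B]; first exact: (csmooth_cst oOm 0).
exact: (csmooth_fieldZ oOm b a (sG B)).
Qed.

Lemma smooth_comb (I : Type) (r : seq I) (c : I -> R[i]) (F : I -> heis R n -> R[i]) :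
  (forall i, csmooth (F i)) -> csmooth (fun x => \sum_(i <- r) c i * F i x).
Proof.
move=> sF; apply: (csmooth_sum oOm) => i.
exact: (csmooth_mul oOm (csmooth_cst oOm (c i)) (sF i)).
Qed.

Lemma smooth_avg (T : Type) e (F : heis R n -> seq T -> R[i]) (t : seq T) :
  (forall u, csmooth (F^~ u)) -> csmooth (fun x => avg e (F x) t).
Proof.
move=> sF; have -> : (fun x => avg e (F x) t) = (fun x => \sum_(s : 'S_(size t))
    (((size t)`!%:R)^-1 * twist e s) * F x (permute s (in_tuple t))).
  by apply: boolp.funext => x; rewrite avg_comb.
by apply: smooth_comb => s; apply: sF.
Qed.

Lemma smooth_alt_form G : smooth_form G -> smooth_form (alt_form G).
Proof. by move=> sG B; apply: smooth_avg. Qed.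

Lemma dform_comb (I : Type) (r : seq I) (c : I -> R[i]) (F : I -> form) a x A :
  (forall i, smooth_form (F i)) -> Om x ->
  dform a (fun y B => \sum_(i <- r) c i * F i y B) x A =
  \sum_(i <- r) c i * dform a (F i) x A.
Proof.
move=> sF Omx; case: A => [|b B] /=; first by rewrite big1// => i _; rewrite mulr0.
exact: (fieldZ_sum oOm b a r c (fun i => sF i B) Omx).
Qed.

Lemma alt_dform_comb (I : Type) (r : seq I) (c : I -> R[i]) (F : I -> form) a x A :
  (forall i, smooth_form (F i)) -> Om x ->
  alt_form (dform a (fun y B => \sum_(i <- r) c i * F i y B)) x A =
  \sum_(i <- r) c i * alt_form (dform a (F i)) x A.
Proof.
move=> sF Omx; rewrite /alt_form -avg_sum; apply: avg_ext => B _.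
exact: dform_comb.
Qed.

Lemma alt_dform_scale (c : R[i]) G a x A : smooth_form G -> Om x ->
  alt_form (dform a (fun y B => c * G y B)) x A = c * alt_form (dform a G) x A.
Proof.
move=> sG Omx.
have := alt_dform_comb [:: tt] (fun=> c) a A (fun=> sG) Omx.
rewrite big_seq1 => <-; congr (alt_form (dform a _) x A).
by apply: boolp.funext => y; apply: boolp.funext => B; rewrite big_seq1.
Qed.

Lemma alt_dform_avg (T : Type) e (F : seq T -> form) (t : seq T) a x A :
  (forall u, smooth_form (F u)) -> Om x ->
  alt_form (dform a (fun y B => avg e (fun u => F u y B) t)) x A =
  avg e (fun u => alt_form (dform a (F u)) x A) t.
Proof.
move=> sF Omx; rewrite [RHS]avg_comb.
rewrite -(alt_dform_comb (index_enum 'S_(size t)) _ a A (fun s => sF _) Omx).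
congr (alt_form (dform a _) x A).
by apply: boolp.funext => y; apply: boolp.funext => B; rewrite avg_comb.
Qed.

(** Equality is asked only at lists of the right length: elsewhere [entry]
takes its default value and the identities between components fail. *)
Lemma alt_dform_eq a G H x A : Om x ->
  (forall y B, Om y -> size B = (size A).-1 -> G y B = H y B) ->
  alt_form (dform a G) x A = alt_form (dform a H) x A.
Proof.
move=> Omx GH; apply: avg_ext => -[|b B] sB; first by [].
by apply: (fieldZ_eq_on oOm b a _ Omx) => y Omy; apply: GH; rewrite -?sB.
Qed.

Lemma alt_dform_eq0 a G x A : Om x ->
  (forall y B, Om y -> size B = (size A).-1 -> G y B = 0) ->
  alt_form (dform a G) x A = 0.
Proof.
move=> Omx G0; rewrite -(big_nil 0 +%R xpredT
  (fun i : void => 0 * alt_form (dform a (fun=> fun=> 0)) x A)).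
rewrite -(alt_dform_comb [::] (fun=> 0) a A (fun _ _ => csmooth_cst oOm 0) Omx).
by apply: alt_dform_eq => // y B Omy sB; rewrite big_nil G0.
Qed.

(** [fieldZ b a] is linear, so it passes under the inner average, which the
outer one then absorbs. *)
Lemma alt_dform_alt a G x A : smooth_form G -> Om x ->
  alt_form (dform a (alt_form G)) x A = alt_form (dform a G) x A.
Proof.
move=> sG Omx; rewrite -[RHS]avg_absorb; apply: avg_ext => -[|b B] _.
  by [].
rewrite /= avg_comb -(fieldZ_sum oOm b a _ _ (fun s => sG _) Omx).
by congr (fieldZ b a _ x); apply: boolp.funext => y; rewrite /alt_form avg_comb.
Qed.

(** By [fieldZ_anticomm], the sum of [d_a d_b G] and [d_b d_a G] is symmetric in
the first two unprimed indices, so its antisymmetrisation vanishes. *)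
Lemma alt_dform_anticomm a b G x A : smooth_form G -> Om x -> (1 < size A)%N ->
  alt_form (dform a (dform b G)) x A = - alt_form (dform b (dform a G)) x A.
Proof.
move=> sG Omx sA; apply/eqP; rewrite -addr_eq0; apply/eqP.
rewrite -avgD; apply: avg_swap0 => // p q u.
rewrite expr1 opprK mul1r /dform /=.
rewrite [RHS]addrC; exact: (fieldZ_anticomm oOm q a p b (sG u) Omx).
Qed.

Lemma alt_dform_square a G x A : smooth_form G -> Om x -> (1 < size A)%N ->
  alt_form (dform a (dform a G)) x A = 0.
Proof.
move=> sG Omx sA; apply/eqP; have /eqP := alt_dform_anticomm a a sG Omx sA.
by rewrite -subr_eq0 opprK -mulr2n mulrn_eq0.
Qed.

(** Two of three primed indices agree; anticommutation brings them next to each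
other. *)
Lemma alt_dform_cube a b c G x A : smooth_form G -> Om x -> (2 < size A)%N ->
  alt_form (dform a (dform b (dform c G))) x A = 0.
Proof.
move=> sG Omx sA.
have inner p q : alt_form (dform p (dform q (dform q G))) x A = 0.
  rewrite -(alt_dform_alt p A (smooth_dform q (smooth_dform q sG)) Omx).
  apply: alt_dform_eq0 => // y B Omy sB; apply: alt_dform_square => //.
  by rewrite sB; case: (size A) sA => [|[|[|]]].
have outer p q : alt_form (dform p (dform p (dform q G))) x A = 0.
  exact: (alt_dform_square p (smooth_dform q sG) Omx (ltnW sA)).
have [->|bc] := eqVneq b c; first exact: inner.
have [->|ab] := eqVneq a b; first exact: outer.
(* There are only two primed indices. *)
have -> : c = a.
  by move: a b c ab bc => [[|[|//]] ?] [[|[|//]] ?] [[|[|//]] ?] //= _ _; apply: val_inj.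
rewrite -(alt_dform_alt a A (smooth_dform b (smooth_dform a sG)) Omx).
have E : alt_form (dform a (alt_form (dform b (dform a G)))) x A =
    alt_form (dform a (fun y B => -1 * alt_form (dform a (dform b G)) y B)) x A.
  apply: alt_dform_eq => // y B Omy sB; rewrite mulN1r.
  apply: alt_dform_anticomm => //; rewrite sB.
  by case: (size A) sA => [|[|[|]]].
have sb : smooth_form (dform a (dform b G)) by do 2! apply: smooth_dform.
rewrite E (alt_dform_scale (-1) a A (smooth_alt_form sb) Omx).
by rewrite (alt_dform_alt a A sb Omx) outer mulr0.
Qed.

End Forms.

(** * The operators of the complex *)

Lemma entry_tuple (R : realType) n p q (f : tensor R n p q) (P : p.-tuple 'I_2)
    (A : q.-tuple 'I_(n.*2)) : entry f P A = f P A.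
Proof. by rewrite /entry !valK. Qed.

Lemma entry_size (R : realType) n p q (f : tensor R n p q) P A
    (sP : size P == p) (sA : size A == q) : entry f P A = f (Tuple sP) (Tuple sA).
Proof. exact: (entry_tuple f (Tuple sP) (Tuple sA)). Qed.

Lemma entry_sym (R : realType) n p q (f : tensor R n p q) P Q A :
  sym_alt f -> perm_eq P Q -> entry f P A = entry f Q A.
Proof.
move=> [symf _] PQ; rewrite /entry; case: insubP => [P' _ PE|sP]; last first.
  by rewrite insubN // -(perm_size PQ).
have sQ : size Q == p by rewrite -(perm_size PQ) -PE size_tuple.
rewrite (insubT (fun s : seq 'I_2 => size s == p) sQ).
have /tuple_permP[s Ps] : perm_eq P' (Tuple sQ) by rewrite PE.
have -> : P' = permute s (Tuple sQ) by apply: val_inj.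
by case: insubP => // A' _ _; rewrite symf.
Qed.

Lemma perm_permute (T : eqType) m (s : 'S_m) (t : m.-tuple T) : perm_eq (permute s t) t.
Proof. by apply/tuple_permP; exists s. Qed.

Section Operators.
Context {R : realType} {n k : nat} {Om : set (heis R n)}.
Hypothesis oOm : open Om.
Local Notation form := (heis R n -> seq 'I_(n.*2) -> R[i]).

(** A field of tensors seen as a family of forms indexed by lists of primed
indices: lists avoid the casts between the index counts of successive spaces. *)
Definition component j (f : Vfield R n k j) (Q : seq 'I_2) : form :=
  fun y B => entry (f y) Q B.

Lemma smooth_component j (f : Vfield R n k j) Q : Cinfty Om f ->
  smooth_form (Om := Om) (component f Q).
Proof.
move=> [_ sf] B; rewrite /component /entry.
case: insubP => [Q' _ _|_]; last exact: (csmooth_cst oOm).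
case: insubP => [B' _ _|_]; last exact: (csmooth_cst oOm).
exact: sf.
Qed.

Lemma component_opD_lt j (f : Vfield R n k j) Q y B : (j < k)%N ->
  size Q = pdeg k j.+1 -> size B = qdeg k j.+1 ->
  component (opD f) Q y B =
  j.+1%:R * \sum_(a < 2) alt_form (dform a (component f (a :: Q))) y B.
Proof.
move=> jk /eqP sQ /eqP sB; rewrite /component (entry_size _ sQ sB) /opD jk alt_avg.
congr (_ * _); under [RHS]eq_bigr do rewrite -[alt_form _ _ _]mul1r.
rewrite -avg_sum; apply: avg_ext => -[|b u] _ /=.
  by rewrite big1// => a _; rewrite mulr0.
by apply: eq_bigr => a _; rewrite mul1r.
Qed.

Lemma component_opD_eq j (f : Vfield R n k j) Q y B : j = k ->
  size Q = pdeg k j.+1 -> size B = qdeg k j.+1 ->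
  component (opD f) Q y B =
  k.+2%:R * alt_form (dform ord0 (dform ord_max (component f [::]))) y B.
Proof.
move=> jk /eqP sQ /eqP sB; have sB2 : (1 < size B)%N.
  by rewrite (eqP sB) /qdeg jk ltnn.
have [jk1 jk2] : (j < k)%N = false /\ j == k by rewrite jk ltnn eqxx.
rewrite /component (entry_size _ sQ sB) /opD jk1 jk2 alt_avg.
apply: (congr1 ( *%R _)); apply: avg_ext => -[|b [|c u]] su; first by [].
  by rewrite -su in sB2.
by [].
Qed.

(** Antisymmetrisation and symmetrisation act on different indices and may be
exchanged. *)
Lemma component_opD_gt j (f : Vfield R n k j) Q y B : (k < j)%N ->
  size Q = pdeg k j.+1 -> size B = qdeg k j.+1 ->
  component (opD f) Q y B =
  j.+2%:R * avg false (on_cons (fun q Q' => alt_form (dform q (component f Q')) y B)) Q.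
Proof.
move=> kj /eqP sQ /eqP sB; rewrite /component (entry_size _ sQ sB) /opD.
rewrite ltnNge (ltnW kj) /= gtn_eqF// alt_avg; congr (_ * _).
under avg_ext => u _ do rewrite sym_avg.
rewrite avg_exchange; apply: avg_ext => -[|q Q'] _ /=.
  by rewrite -[RHS](avg0 true B); apply: avg_ext => -[|b u].
by apply: avg_ext => -[|b u].
Qed.

Lemma opD_component j (f : Vfield R n k j) y P A :
  opD f y P A = component (opD f) P y A.
Proof. by rewrite /component entry_tuple. Qed.

Lemma smooth_opD j (f : Vfield R n k j) P A :
  Cinfty Om f -> csmooth (Om := Om) (fun y => opD f y P A).
Proof.
move=> sf; have sF Q := smooth_component Q sf.
have [sP sA] := (size_tuple P, size_tuple A).
have scale c (g : heis R n -> R[i]) : csmooth (Om := Om) g ->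
    csmooth (Om := Om) (fun y => c * g y).
  by move=> sg; apply: (csmooth_mul oOm _ sg); apply: (csmooth_cst oOm).
have [jk|kj|jk] := ltngtP j k.
- apply: (csmooth_eq_on oOm (fun y _ => esym (etrans (opD_component f y P A)
    (component_opD_lt f y jk sP sA)))).
  apply: scale; apply: (csmooth_sum oOm) => a.
  by apply: (smooth_alt_form oOm); apply: (smooth_dform oOm).
- apply: (csmooth_eq_on oOm (fun y _ => esym (etrans (opD_component f y P A)
    (component_opD_gt f y kj sP sA)))).
  apply: scale; apply: (smooth_avg oOm) => -[|q Q]; first exact: (csmooth_cst oOm).
  by apply: (smooth_alt_form oOm); apply: (smooth_dform oOm).
- apply: (csmooth_eq_on oOm (fun y _ => esym (etrans (opD_component f y P A)
    (component_opD_eq f y jk sP sA)))).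
  apply: scale; apply: (smooth_alt_form oOm).
  by do 2! apply: (smooth_dform oOm).
Qed.

Lemma sym_alt_opD j (f : Vfield R n k j) x : Om x ->
  Cinfty Om f -> sym_alt (opD f x).
Proof.
move=> Omx [symf _]; split=> s P A.
  rewrite /opD; case: ifP => [jk|_].
    rewrite 2!alt_avg; apply: (congr1 ( *%R _)); apply: avg_ext => -[|b B] _; first by [].
    apply: eq_bigr => a _; apply: (fieldZ_eq_on oOm b a _ Omx) => y Omy.
    by apply: entry_sym; [apply: symf | rewrite perm_cons perm_permute].
  case: ifP => // _; rewrite 2!alt_avg; apply: (congr1 ( *%R _)); apply: avg_ext => B _.
  by rewrite !sym_avg avg_permute /twist mul1r.
by rewrite /opD; case: ifP => [_|_]; [|case: ifP => _];
  rewrite !alt_avg avg_permute mulrCA.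
Qed.

Lemma Cinfty_opD j (f : Vfield R n k j) : Cinfty Om f -> Cinfty Om (opD f).
Proof.
move=> sf; split=> [x Omx|P A]; first exact: sym_alt_opD.
exact: smooth_opD.
Qed.

(** The composition is the sum over [a] and [b] of [d_b d_a f_(a, b)]: the
exchange of [a] and [b] leaves [f] unchanged and changes the sign of the rest. *)
Lemma opD_opD_lt j (f : Vfield R n k j) x P A : (j.+1 < k)%N ->
  Cinfty Om f -> Om x -> size P = pdeg k j.+2 -> size A = qdeg k j.+2 ->
  component (opD (opD f)) P x A = 0.
Proof.
move=> jk sf Omx sP sA; have sF Q := smooth_component Q sf.
rewrite component_opD_lt//.
have -> : \sum_(b < 2) alt_form (dform b (component (opD f) (b :: P))) x A =
    j.+1%:R * \sum_(b < 2) \sum_(a < 2)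
      alt_form (dform b (dform a (component f [:: a, b & P]))) x A.
  rewrite mulr_sumr; apply: eq_bigr => b _; rewrite mulr_sumr.
  under eq_bigr => a _ do
    rewrite -(alt_dform_alt oOm b A (smooth_dform oOm a (sF _)) Omx).
  rewrite -(alt_dform_comb oOm (index_enum 'I_2) (fun=> j.+1%:R) b A
    (fun a => smooth_alt_form oOm (smooth_dform oOm a (sF _))) Omx).
  apply: (alt_dform_eq oOm _ Omx) => y B Omy sB.
  rewrite component_opD_lt ?mulr_sumr//; first exact: ltnW.
    by move: sP jk => /=; rewrite /pdeg; do 2! case: ifP; lia.
  by move: sA sB jk; rewrite /qdeg; do 2! case: ifP; lia.
have s2 : (1 < size A)%N by rewrite sA /qdeg; case: ifP.
set S := \sum_(b < 2) _.
suff S0 : S = - S.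
  have /eqP := S0; rewrite -subr_eq0 opprK -mulr2n mulrn_eq0 /= => /eqP ->.
  by rewrite !mulr0.
rewrite {1}/S exchange_big -sumrN; apply: eq_bigr => a _.
rewrite -sumrN; apply: eq_bigr => b _.
rewrite [LHS](alt_dform_anticomm oOm b a (sF _) Omx s2).
apply: (congr1 -%R).
apply: (alt_dform_eq oOm _ Omx) => y [|c B] Omy sB; first by [].
apply: (fieldZ_eq_on oOm _ _ _ Omy) => z Omz.
by apply: entry_sym; [apply: sf.1 | exact: (permEl (perm_catCA [:: a] [:: b] P))].
Qed.

(** The composition is the sum over [a] of [d_0' d_1' d_a f_a], where [a] repeats
one of the other two indices. *)
Lemma opD_opD_pred j (f : Vfield R n k j) x P A : j.+1 = k ->
  Cinfty Om f -> Om x -> size P = pdeg k j.+2 -> size A = qdeg k j.+2 ->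
  component (opD (opD f)) P x A = 0.
Proof.
move=> jk sf Omx sP sA; have sF Q := smooth_component Q sf.
have s3 : size A = j.+3 by rewrite sA /qdeg jk ltnn.
have sdf a := smooth_dform oOm a (sF [:: a]).
have s1df a := smooth_dform oOm ord_max (sdf a).
have sD : smooth_form (Om := Om) (component (opD f) [::]).
  exact: (smooth_component _ (Cinfty_opD sf)).
rewrite component_opD_eq// -(alt_dform_alt oOm ord0 A (smooth_dform oOm ord_max sD) Omx).
have E y B : Om y -> size B = (size A).-1 ->
    alt_form (dform ord_max (component (opD f) [::])) y B =
    \sum_(a < 2) j.+1%:R * alt_form (dform ord_max (dform a (component f [:: a]))) y B.
  move=> Omy sB.
  under eq_bigr => a _ do rewrite -(alt_dform_alt oOm ord_max B (sdf a) Omy).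
  rewrite -(alt_dform_comb oOm (index_enum 'I_2) (fun=> j.+1%:R) ord_max B
    (fun a => smooth_alt_form oOm (sdf a)) Omy).
  apply: (alt_dform_eq oOm _ Omy) => z C Omz sC; rewrite -mulr_sumr.
  apply: component_opD_lt; first by rewrite -jk.
    by rewrite /pdeg jk leqnn subnn.
  by rewrite sC sB s3 /qdeg jk leqnn.
rewrite (alt_dform_eq oOm ord0 Omx E).
rewrite (alt_dform_comb oOm (index_enum 'I_2) (fun=> j.+1%:R) ord0 A
  (fun a => smooth_alt_form oOm (s1df a)) Omx).
rewrite big1 ?mulr0// => a _.
rewrite (alt_dform_alt oOm ord0 A (s1df a) Omx).
by rewrite (alt_dform_cube oOm _ _ _ (sF _) Omx) ?mulr0// s3.
Qed.

(** The only primed index [q] of the target gives [d_q d_0' d_1' f], where [q]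
repeats one of the other two indices. *)
Lemma opD_opD_eq (f : Vfield R n k k) x P A :
  Cinfty Om f -> Om x -> size P = pdeg k k.+2 -> size A = qdeg k k.+2 ->
  component (opD (opD f)) P x A = 0.
Proof.
move=> sf Omx sP sA; have sF Q := smooth_component Q sf.
have s3 : size A = k.+3 by rewrite sA /qdeg; case: ifP => //; lia.
rewrite component_opD_gt//.
rewrite (@avg_ext _ _ _ _ (fun=> 0)) => [|[|q Q] sQ] //.
  by rewrite avg0 mulr0.
rewrite /=.
have sdd := smooth_dform oOm ord0 (smooth_dform oOm ord_max (sF [::])).
have E : alt_form (dform q (component (opD f) Q)) x A =
    alt_form (dform q (fun y B => k.+2%:R *
      alt_form (dform ord0 (dform ord_max (component f [::]))) y B)) x A.
  apply: (alt_dform_eq oOm _ Omx) => y B Omy sB.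
  apply: component_opD_eq => //; last by rewrite sB s3 /qdeg ltnn.
  by move: sQ sP => /=; rewrite /pdeg; do ? case: ifP; lia.
rewrite E (alt_dform_scale oOm _ q A (smooth_alt_form oOm sdd) Omx).
have s2 : (2 < size A)%N by rewrite s3.
rewrite (alt_dform_alt oOm q A sdd Omx).
by rewrite (alt_dform_cube oOm q ord0 ord_max (sF [::]) Omx s2) mulr0.
Qed.

(** The inner symmetrisation is absorbed by the outer one, which then kills
[d_q d_r f], antisymmetric in the first two primed indices. *)
Lemma opD_opD_gt j (f : Vfield R n k j) x P A : (k < j)%N ->
  Cinfty Om f -> Om x -> size P = pdeg k j.+2 -> size A = qdeg k j.+2 ->
  component (opD (opD f)) P x A = 0.
Proof.
move=> kj sf Omx sP sA; have sF Q := smooth_component Q sf.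
rewrite component_opD_gt//; last exact: ltnW.
pose W (Q : seq 'I_2) y B : R[i] :=
  on_cons (fun q Q' => alt_form (dform q (component f Q')) y B) Q.
have sW Q : smooth_form (Om := Om) (W Q).
  case: Q => [|q Q] B; first exact: (csmooth_cst oOm).
  exact: (smooth_alt_form oOm (smooth_dform oOm q (sF Q))).
have s2 : (1 < size A)%N by rewrite sA /qdeg; case: ifP.
have s2P : (1 < size P)%N by rewrite sP /pdeg; case: ifP; lia.
pose H q Q := alt_form (dform q (W Q)) x A.
have -> : avg false (on_cons (fun q Q => alt_form (dform q (component (opD f) Q)) x A)) P
    = j.+2%:R * avg false (on_cons H) P.
  rewrite -[X in _ = _ * X]avg_absorb -avg_scale; apply: avg_ext => -[|q Q] sQ.
    by rewrite mulr0.
  have sc : smooth_form (Om := Om) (fun y B => avg false (fun u => W u y B) Q).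
    by move=> B; apply: (smooth_avg oOm) => u; apply: sW.
  rewrite /= -(alt_dform_avg oOm false Q q A sW Omx) -(alt_dform_scale oOm _ q A sc Omx).
  apply: (alt_dform_eq oOm _ Omx) => y B Omy sB.
  apply: component_opD_gt => //.
    by move: sQ sP => /=; rewrite /pdeg; do ? case: ifP; lia.
  by move: sB sA; rewrite /qdeg; do ? case: ifP; lia.
rewrite avg_swap0 ?mulr0// => q r Q /=.
rewrite expr0 mulN1r /H /W /=.
have sd a b := smooth_dform oOm a (sF b).
rewrite [LHS](alt_dform_alt oOm r A (sd q Q) Omx).
rewrite [X in - X](alt_dform_alt oOm q A (sd r Q) Omx).
exact: (alt_dform_anticomm oOm r q (sF Q) Omx s2).
Qed.

End Operators.

Theorem theorem2p1 (R : realType) (n k : nat) (Omega : set (heis R n))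
    (hOmega : domain Omega) :
  (* D_j maps C^oo(Omega, V_j) to C^oo(Omega, V_{j+1}), 0 <= j <= 2n-2 *)
  (forall (j : nat) (f : Vfield R n k j),
     (j.+1 < n.*2)%N -> Cinfty Omega f -> Cinfty Omega (opD f)) /\
  (* D_{j+1} o D_j = 0, 0 <= j <= 2n-3 *)
  (forall (j : nat) (f : Vfield R n k j),
     (j.+2 < n.*2)%N -> Cinfty Omega f ->
     forall x, Omega x -> forall P A, opD (opD f) x P A = 0%R).
Proof.
have [oOm _ _] := hOmega; split=> [j f _ sf|j f _ sf x Omx P A].
  exact: (Cinfty_opD oOm).
rewrite opD_component; have [sP sA] := (size_tuple P, size_tuple A).
have [jk|kj|jk] := ltngtP j k; last 2 first.
- exact: (opD_opD_gt oOm).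
- by subst j; apply: (opD_opD_eq oOm).
have [jk'|kj|jk'] := ltngtP j.+1 k; first exact: (opD_opD_lt oOm).
- by move: jk kj; rewrite ltnS => /leq_trans h /h; rewrite ltnn.
- exact: (opD_opD_pred oOm).
Qed.
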